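(* Let $k$ be a field, let $d$ be a non-negative integer, and let $I\subseteq k[x_1,\dots,x_n]$ be a monomial ideal generated in degree $d$ (that is, all minimal monomial generators of $I$ have degree $d$). Let $L=L(I)$ be its lcm-lattice. Then $I$ has linear quotients if and only if $L$ is $d$-degree graded and CL-shellable.
   Context: Monomial ideals. A monomial ideal $I$ has a unique minimal set of monomial generators, denoted $G(I)$. For ideals $A,B$ of a commutative ring $R$, the colon ideal is $(A:B)=\{r\in R\mid rB\subseteq A\}$. The monomial ideal $I$ has linear quotients if there is an ordering $m_1,\dots,m_r$ of the elements of $G(I)$ such that for all $1\le i\le r$ the colon ideal $((m_1,\dots,m_{i-1}):(m_i))$ is generated by variables (a possibly empty subset of $\{x_1,\dots,x_n\}$). Lcm-lattice. $L(I)$ is the finite atomic lattice whose elements are the least common multiples of all subsets of $G(I)$ (the lcm of the empty set being $1$), ordered by divisibility. Its minimum is $1$, and its atoms are the elements of $G(I)$. In a poset, $a\prec b$ ($b$ covers $a$) means $a<b$ and there is no $c$ with $a<c<b$. Degree-graded. $L(I)$ is degree-graded if for all $a,b\in L(I)$ with $a\neq 1$ and $b\ne 1$, $a\prec b$ implies $\deg(b)=\deg(a)+1$ (degrees as monomials). It is $d$-degree graded if it is degree-graded and its atoms (the minimal generators of $I$) all have degree $d$. CL-shellability. A finite poset is graded if it is bounded (has a minimum $\hat 0$ and a maximum $\hat 1$) and all its maximal chains have the same length. A graded poset is CL-shellable (in the sense of Björner and Wachs) if and only if it admits a recursive atom ordering; this may be taken as the definition. A graded poset $P$ admits a recursive atom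 ordering if either $P\setminus\{\hat 0,\hat 1\}=\emptyset$, or there is an ordering $a_1,\dots,a_t$ of the atoms of $P$ such that: (i) for all $1\le j\le t$ the interval $[a_j,\hat 1]$ admits a recursive atom ordering in which the atoms of $[a_j,\hat 1]$ that cover some $a_i$ with $i<j$ appear before the atoms that do not have this property; (ii) for all $1\le i<j\le t$ there exists $k<j$ such that for all $y\in P$ with $a_i,a_j\le y$ there exists $z\in P$ with $a_k\prec z$, $a_j\prec z$ and $z\le y$. *)

(* Defs.v *)
From HB Require Import structures.
From mathcomp Require Import all_boot all_order all_algebra.
From mathcomp Require Import finmap mpoly.
From mathcomp Require Import boolp classical_sets cardinality.

Set Implicit Arguments.
Unset Strict Implicit.
Unset Printing Implicit Defensive.

Import Order.TTheory GRing.Theory.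

Local Open Scope classical_set_scope.
Local Open Scope ring_scope.

Definition ideal_gen (R : comNzRingType) (A : set R) : set R :=
  [set r | exists s : seq (R * R),
     (forall p, p \in s -> A p.2) /\ r = \sum_(p <- s) p.1 * p.2].

Definition colon_ideal (R : comNzRingType) (A B : set R) : set R :=
  [set r | forall b, B b -> A (r * b)].

Section MonomialIdeals.
Variables (k : fieldType) (n : nat).
Implicit Types (I : set {mpoly k[n]}) (G : set 'X_{1..n}).

Definition monomial_span G : set {mpoly k[n]} :=
  ideal_gen [set 'X_[m] | m in G].

Definition monomial_ideal I : Prop := exists G, I = monomial_span G.

Definition is_min_monomial_gens I G : Prop :=
  I = monomial_span G /\
  forall G', G' `<=` G -> I = monomial_span G' -> G' = G.

(* The generating set G(I): a monomial ideal has exactly one minimal set of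
   monomial generators, so this is membership in that set. *)
Definition min_gens I : set 'X_{1..n} :=
  [set m | exists2 G, is_min_monomial_gens I G & G m].

Definition generated_in_degree (d : nat) I : Prop :=
  forall m, min_gens I m -> mdeg m = d.

Definition linear_quotients I : Prop :=
  exists s : seq 'X_{1..n},
    [/\ uniq s, (forall m, m \in s <-> min_gens I m)
      & forall i, (i < size s)%N ->
          exists S : {set 'I_n},
            colon_ideal (monomial_span [set` take i s])
                        (monomial_span [set nth 0%MM s i])
            = ideal_gen [set 'X_j | j in [set` S]]].

End MonomialIdeals.

(* The poset under consideration is a subset P of an ambient ordered type,
   with the induced order, so that intervals of P are again such subsets. *)
Section Posets.
Local Open Scope order_scope.
Variables (disp : Order.disp_t) (T : porderType disp).
Implicit Types (P : set T) (a b x y z : T) (c s t : seq T).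

Definition is_minimum P x : Prop := P x /\ lbound P x.
Definition is_maximum P x : Prop := P x /\ ubound P x.

Definition interval_in P a b : set T := [set x | P x /\ a <= x <= b].

Definition covers P a b : Prop :=
  [/\ P a, P b, a < b & forall x, P x -> ~ (a < x < b)].

Definition atoms P : set T :=
  [set a | exists2 bot, is_minimum P bot & covers P bot a].

Definition chain P c : Prop := sorted <%O c /\ (forall x, x \in c -> P x).

Definition maximal_chain P c : Prop :=
  chain P c /\ forall c', chain P c' -> {subset c <= c'} -> c' = c.

Definition graded_poset P : Prop :=
  [/\ finite_set P,
      exists bot, is_minimum P bot,
      exists top, is_maximum P top
    & forall c c', maximal_chain P c -> maximal_chain P c' -> size c = size c'].

Definition atom_ordering P s : Prop :=
  uniq s /\ forall a, a \in s <-> atoms P a.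

Definition covers_earlier P s (j : nat) x : Prop :=
  exists i a, [/\ (i < j)%N, onth s i = Some a & covers P a x].

(* In the trivial case there is at most one atom, so every enumeration of the
   atoms is accepted as an ordering. *)
Inductive recursive_atom_ordering P s : Prop :=
| RAO_trivial bot top of
    is_minimum P bot & is_maximum P top &
    P `\` [set bot; top] = set0 &
    atom_ordering P s
| RAO_step top of
    is_maximum P top &
    atom_ordering P s &
    (forall j aj, onth s j = Some aj ->
       exists2 t, recursive_atom_ordering (interval_in P aj top) t &
         forall x y, x \in t -> y \in t ->
           covers_earlier P s j x -> ~ covers_earlier P s j y ->
           (index x t < index y t)%N) &
    (forall i j ai aj, (i < j)%N -> onth s i = Some ai -> onth s j = Some aj ->
       exists l al, [/\ (l < j)%N, onth s l = Some al
         & forall y, P y -> ai <= y -> aj <= y ->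
             exists z, [/\ P z, covers P al z, covers P aj z & z <= y]]).

Definition CL_shellable P : Prop :=
  graded_poset P /\ exists s, recursive_atom_ordering P s.

End Posets.

(* Monomials ordered by divisibility; the canonical order of 'X_{1..n} is
   the total degrevlex order. *)
Definition mnmdvd (n : nat) : Type := 'X_{1..n}.

Fact mnmdvd_display : Order.disp_t. Proof. exact: Order.Disp tt tt. Qed.

Section MonomialDivisibility.
Variable n : nat.

Definition mdvd (m1 m2 : mnmdvd n) : bool := (m1 <= m2)%MM.

Fact mdvd_refl : reflexive mdvd. Proof. exact: lepm_refl. Qed.

Fact mdvd_anti : antisymmetric mdvd.
Proof.
move=> m1 m2 /andP[/mnm_lepP le12 /mnm_lepP le21].
by apply/mnmP => i; apply/eqP; rewrite eqn_leq le12 le21.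
Qed.

Fact mdvd_trans : transitive mdvd.
Proof. by move=> m2 m1 m3; exact: lepm_trans. Qed.

HB.instance Definition _ := Choice.copy (mnmdvd n) 'X_{1..n}.
HB.instance Definition _ := Order.Le_isPOrder.Build mnmdvd_display (mnmdvd n)
  mdvd_refl mdvd_anti mdvd_trans.

End MonomialDivisibility.

Section LcmLattice.
Variables (k : fieldType) (n : nat).
Implicit Type I : set {mpoly k[n]}.

Definition lcm_lattice I : set (mnmdvd n) :=
  [set u | exists2 A : {fset 'X_{1..n}},
     [set` A] `<=` min_gens I & u = \big[@mlcm n/0%MM]_(m <- A) m].

Definition degree_graded (L : set (mnmdvd n)) : Prop :=
  forall a b : mnmdvd n, a <> 0%MM -> b <> 0%MM -> covers L a b ->
    mdeg b = (mdeg a).+1.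

Definition d_degree_graded (d : nat) (L : set (mnmdvd n)) : Prop :=
  degree_graded L /\ forall a, atoms L a -> mdeg a = d.

End LcmLattice.

(* Main.v *)
(* With all generators of degree [d], linear quotients mean that for [i < j] some
   [m_l] with [l < j] satisfies [lcm(m_l, m_j) = m_j x_t] and [m_j x_t] divides
   [lcm(m_i, m_j)]; this is condition (ii) of a recursive atom ordering of [L],
   once one knows that covers raise the degree by one. Conversely, descending
   along the order [m_1, .., m_r] shows that any two generators [u], [v] are
   joined, among the divisors of [lcm(u, v)], by steps raising the degree of the
   lcm by one; leaving the divisors of [a] along such a path from a generator
   dividing [a] yields some [a x_t] in [L] below any given [b > a]. Hence [L] is
   degree-graded, and for [a <> 1] the atoms of [[a, top]] are of the form
   [a x_t], so that every ordering of them is recursive. *)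
Require Import Defs.
From mathcomp Require Import all_boot all_order all_algebra.
From mathcomp Require Import mpoly boolp classical_sets.
From mathcomp Require Import finmap cardinality zify.

Set Implicit Arguments.
Unset Strict Implicit.
Unset Printing Implicit Defensive.

Import Order.TTheory GRing.Theory.

Local Open Scope classical_set_scope.
Local Open Scope ring_scope.

(** * Graded posets via a rank function *)

Section GradedPosets.
Local Open Scope order_scope.
Variables (disp : Order.disp_t) (T : porderType disp) (P : set T).
Implicit Types (a b x y z : T) (c : seq T).

Lemma interval_in_top top b : is_maximum P top -> P b ->
  is_maximum (interval_in P b top) top.
Proof.
move=> [Ptop maxtop] Pb; split; last by move=> x [_ /andP[]].
by split=> //; rewrite lexx maxtop.
Qed.

(** Maximality would make the longer chain equal to [c], against their sizes. *)
Lemma maximal_chain_insert c c1 c2 z : maximal_chain P c -> c = c1 ++ c2 ->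
  P z -> ~ sorted <%O (c1 ++ z :: c2).
Proof.
move=> [[_ Pc] maxc] eq_c Pz srt; have: size (c1 ++ z :: c2) = size c.
  congr size; apply: maxc; first split=> // x.
    by rewrite mem_cat inE orbCA -mem_cat -eq_c => /orP[/eqP->|/Pc].
  by move=> x; rewrite eq_c !mem_cat inE => /orP[]->; rewrite ?orbT.
by rewrite eq_c !size_cat /= addnS; elim: (_ + _)%N => // m ih [].
Qed.

(** A maximal chain runs from [bot] to [top] through covers, since otherwise an element could be
    inserted; its size is thus [rk top - rk bot + 1]. *)
Lemma graded_of_rank (rk : T -> nat) bot top :
  finite_set P -> is_minimum P bot -> is_maximum P top ->
  (forall a b, covers P a b -> rk b = (rk a).+1) -> graded_poset P.
Proof.
move=> finP minP maxP rkP; split=> //; [by exists bot | by exists top |].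
have [[Pbot lebot] [Ptop letop]] := (minP, maxP).
suff size_mc c : maximal_chain P c -> (size c + rk bot = (rk top).+1)%N.
  move=> c c' /size_mc + /size_mc.
  by move=> <- /addIn.
move=> mc; have [[srt Pc] _] := mc.
have tail c2 : forall c1 x, c = c1 ++ x :: c2 -> (size c2 + rk x = rk top)%N.
  elim: c2 => [|y c2 ih] c1 x eq_c; have Px : P x.
  - by apply: Pc; rewrite eq_c mem_cat mem_head orbT.
  - rewrite add0n; case: (eqVneq x top) => [->//|ne_xt].
    case: (maximal_chain_insert mc (c1 := c) (c2 := [::]) _ Ptop).
      by rewrite cats0.
    move: srt; rewrite eq_c -catA sorted_cat_cons /= andbT => srt1.
    by rewrite sorted_cat_cons srt1 /= lt_neqAle ne_xt letop.
  - by apply: Pc; rewrite eq_c mem_cat mem_head orbT.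
  have Py : P y by apply: Pc; rewrite eq_c mem_cat !inE eqxx !orbT.
  move: (srt); rewrite {1}eq_c sorted_cat_cons /= => /and3P[srt1 lt_xy pth].
  rewrite -(ih (rcons c1 x) y) ?cat_rcons // (rkP x y) ?addnS ?addSn //.
  split=> // z Pz /andP[lt_xz lt_zy].
  case: (maximal_chain_insert mc (c1 := rcons c1 x) (c2 := y :: c2) _ Pz).
    by rewrite cat_rcons.
  by rewrite cat_rcons sorted_cat_cons /= srt1 lt_xz lt_zy.
case: c mc srt Pc tail => [|x c2] mc srt Pc tail.
  by case: (maximal_chain_insert mc (c1 := [::]) (c2 := [::]) _ Pbot).
rewrite -(tail c2 [::] x) //=.
suff -> : x = bot by [].
apply/eqP; apply/negP => /negP ne_xb.
have := @maximal_chain_insert _ [::] (x :: c2) bot mc erefl Pbot; apply => /=.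
rewrite [path _ _ _]srt andbT lt_neqAle eq_sym ne_xb lebot //.
by apply: Pc; rewrite mem_head.
Qed.

End GradedPosets.

(** * Degrees and divisibility of monomials *)

Section Monomials.
Variable n : nat.
Implicit Types (m u v w z : 'X_{1..n}) (s : seq 'X_{1..n}).

Lemma lepm_mdeg m u : (m <= u)%MM -> (mdeg m <= mdeg u)%N.
Proof. by move=> /submK <-; rewrite mdegD leq_addl. Qed.

Lemma lepm_mdeg_eq m u : (m <= u)%MM -> (mdeg u <= mdeg m)%N -> m = u.
Proof.
move=> /submK <-; rewrite mdegD -{2}[mdeg m]add0n leq_add2r leqn0 mdeg_eq0.
by move=> /eqP ->; rewrite add0m.
Qed.

(** The lcm divides [u (v / w)], because [w] divides [u] too. *)
Lemma mdeg_mlcm_leq w u v : (w <= u)%MM -> (w <= v)%MM ->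
  (mdeg (mlcm u v) + mdeg w <= mdeg u + mdeg v)%N.
Proof.
move=> /mnm_lepP le_wu le_wv; rewrite -{2}(submK le_wv) mdegD addnA leq_add2r.
rewrite -mdegD; apply/lepm_mdeg/mnm_lepP => i; rewrite !mnmE.
by have := le_wu i; have := mnm_lepP le_wv i; lia.
Qed.

Lemma lepm_mdegS m z : (m <= z)%MM -> mdeg z = (mdeg m).+1 ->
  exists i, z = (m + U_(i))%MM.
Proof.
move=> /submK <-; rewrite mdegD -add1n => /addIn /eqP/mdeg1P[i /eqP ->].
by exists i; rewrite addmC.
Qed.

Lemma finite_mdeg_lt b : finite_set [set m : 'X_{1..n} | (mdeg m < b)%N].
Proof.
apply: sub_finite_set (finite_image (@bmnm n b) (finite_finset (X := setT))).
by move=> m lt_mb; exists (BMultinom lt_mb).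
Qed.

(* [z] is [m_j x_t], with [x_t] the generator of the [j]-th colon ideal dividing
   [m_i / gcd(m_i, m_j)]. *)
Definition lq_order s := forall i j, (i < j)%N -> (j < size s)%N ->
  exists l z, [/\ (l < j)%N, (nth 0%MM s l <= z)%MM, (nth 0%MM s j <= z)%MM,
    (z <= mlcm (nth 0%MM s i) (nth 0%MM s j))%MM
    & mdeg z = (mdeg (nth 0%MM s j)).+1].

End Monomials.

(** * Monomial ideals, minimal generators and colon ideals *)

Section MonomialIdealTheory.
Variables (k : fieldType) (n : nat).
Implicit Types (m u v w z : 'X_{1..n}) (s : seq 'X_{1..n}).
Implicit Types (G : set 'X_{1..n}) (f : {mpoly k[n]}).

Lemma monomial_spanP G f : @monomial_span k n G f <->
  forall m, m \in msupp f -> exists2 g, G g & (g <= m)%MM.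
Proof.
split=> [[r [rG ->]] m|supp_f].
  rewrite mcoeff_msupp raddf_sum /= => nz_sum.
  have [p p_r nz_p] : exists2 p, p \in r & (p.1 * p.2)@_m != 0.
    apply/hasP; apply: contraNT nz_sum => /hasPn all0.
    by rewrite big_seq big1 // => p /all0; rewrite negbK => /eqP.
  have [g Gg eq_p2] := rG p p_r; exists g => //.
  move: nz_p; rewrite -eq_p2 -mcoeff_msupp (perm_mem (msuppMX _ _)).
  by case/mapP=> m' _ ->; apply/mnm_lepP => i; rewrite mnmDE leq_addr.
(* Outside the support the value [m] is a dummy. *)
have /choice[g gP] m : exists g, m \in msupp f -> G g /\ (g <= m)%MM.
  by have [/supp_f[g Gg le]|_] := boolP (m \in msupp f); [exists g | exists m].
exists [seq (f@_m *: 'X_[m - g m], 'X_[g m]) | m <- msupp f]; split.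
  by move=> _ /mapP[m m_f ->] /=; exists (g m) => //; case: (gP m m_f).
rewrite big_map [LHS]mpolyE big_seq [RHS]big_seq; apply: eq_bigr => m m_f /=.
by rewrite -scalerAl -mpolyXD submK //; case: (gP m m_f).
Qed.

Lemma monomial_spanX G m :
  @monomial_span k n G 'X_[m] <-> exists2 g, G g & (g <= m)%MM.
Proof.
rewrite monomial_spanP; split=> [|[g Gg le_gm] u].
  by apply; rewrite msuppX mem_head.
by rewrite msuppX inE => /eqP ->; exists g.
Qed.

(** The divisibility-minimal monomials [M] of [I] generate it, by descent on the degree, and lie in
    every monomial generating set; hence they form the only minimal one. *)
Lemma min_gensP (I : set {mpoly k[n]}) : monomial_ideal I -> forall m,
  min_gens I m <-> I 'X_[m] /\ forall u, I 'X_[u] -> (u <= m)%MM -> u = m.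
Proof.
move=> [G0 eqI].
pose M := [set m | I 'X_[m] /\ forall u, I 'X_[u] -> (u <= m)%MM -> u = m].
have minM m : I 'X_[m] -> exists2 u, M u & (u <= m)%MM.
  have [b] := ubnP (mdeg m); elim: b m => // b ih m lt_b Im.
  case: (pselect (exists u, [/\ I 'X_[u], (u <= m)%MM & u <> m])) => [[u]|nu].
    move=> [Iu le_um ne_um]; have [|w Mw le_wu] := ih u _ Iu.
      rewrite ltnS in lt_b; apply: leq_trans lt_b; rewrite ltnNge.
      by apply/negP => /(lepm_mdeg_eq le_um).
    by exists w => //; apply: lepm_trans le_wu le_um.
  exists m; last exact: lepm_refl.
  split=> // u Iu le_um; apply: contrapT => ne_um.
  by apply: nu; exists u.
have sub_gens G : I = @monomial_span k n G -> M `<=` G.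
  move=> eqG m [Im min_m]; have := Im; rewrite {1}eqG => /monomial_spanX[g Gg le].
  by rewrite -(min_m g) // eqG; apply/monomial_spanX; exists g; rewrite ?lepm_refl.
have genM : I = @monomial_span k n M.
  apply/seteqP; split=> f If.
    apply/monomial_spanP => m m_f; move: If; rewrite eqI => /monomial_spanP.
    move=> /(_ m m_f)[g G0g le_gm]; have [|u Mu le_ug] := minM g.
      by rewrite eqI; apply/monomial_spanX; exists g; rewrite ?lepm_refl.
    by exists u => //; apply: lepm_trans le_ug le_gm.
  rewrite eqI; apply/monomial_spanP => m m_f.
  have [u [Iu _] le_um] := proj1 (monomial_spanP _ _) If m m_f.
  move: Iu; rewrite eqI => /monomial_spanX[g G0g le_gu].
  by exists g => //; apply: lepm_trans le_gu le_um.
move=> m; split=> [[G [eqG minG] Gm]|Mm].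
  suff : M m by [].
  by rewrite (minG M (sub_gens G eqG) genM).
exists M => //; split=> // G' subG' eqG'.
by apply/seteqP; split=> //; apply: sub_gens.
Qed.

Lemma colon_monomial_spanP s m f :
  colon_ideal (@monomial_span k n [set` s]) (@monomial_span k n [set m]) f <->
  forall u, u \in msupp f -> exists2 g, g \in s & (g <= u + m)%MM.
Proof.
split=> [/(_ 'X_[m])|supp_f b /monomial_spanP supp_b].
  have Xm : @monomial_span k n [set m] 'X_[m] by apply/monomial_spanX; exists m; rewrite ?lepm_refl.
  move=> /(_ Xm)/monomial_spanP supp_fm u u_f; apply: supp_fm.
  by rewrite (perm_mem (msuppMX _ _)); apply/mapP; exists u; rewrite // addmC.
apply/monomial_spanP => w /msuppM_le/allpairsP[[u v] /= [u_f v_b ->]].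
have [_ -> le_mv] := supp_b v v_b; have [g g_s le_g] := supp_f u u_f.
exists g => //; apply: lepm_trans le_g _; apply/mnm_lepP => i.
by rewrite !mnmDE leq_add2l; apply: (mnm_lepP le_mv).
Qed.

Lemma linear_quotientsE (I : set {mpoly k[n]}) : monomial_ideal I ->
  linear_quotients I <->
  exists s, [/\ uniq s, forall m, m \in s <-> min_gens I m & lq_order s].
Proof.
move=> monI; have gensP := min_gensP monI.
have vars (S : {set 'I_n}) : ideal_gen [set 'X_j | j in [set` S]] =
    @monomial_span k n [set U_(j)%MM | j in [set` S]].
  by rewrite /monomial_span -image_comp.
split=> -[s [uniq_s mem_s lq]]; exists s; split=> //.
  move=> i j lt_ij lt_j; have [S] := lq j lt_j; rewrite vars.
  set mi := nth _ s i; set mj := nth _ s j; move=> eq_colon.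
  (* The monomial [lcm(m_i, m_j) / m_j] lies in the colon ideal, so some [x_t] with [t] in [S]
     divides it; [z] will be [x_t m_j]. *)
  have [] := proj1 (monomial_spanX [set U_(j)%MM | j in [set` S]] (mlcm mi mj - mj)).
    rewrite -eq_colon; apply/colon_monomial_spanP => u; rewrite msuppX inE.
    move=> /eqP ->; exists mi; last by rewrite submK ?lem_mlcml ?lem_mlcmr.
    by rewrite /mi -(nth_take _ lt_ij) mem_nth // size_takel // ltnW.
  move=> _ [t St <-] le_t.
  have : @monomial_span k n [set U_(j)%MM | j in [set` S]] 'X_[U_(t)].
    by apply/monomial_spanX; exists U_(t)%MM; [exists t | exact: lepm_refl].
  rewrite -eq_colon => /colon_monomial_spanP/(_ U_(t)%MM).
  rewrite msuppX mem_head => /(_ isT)[g /(nthP 0%MM)[l]].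
  rewrite size_takel; last exact: ltnW.
  move=> lt_lj; rewrite nth_take // => <- le_l.
  exists l, (U_(t) + mj)%MM; split=> //.
  - by apply/mnm_lepP => x; rewrite mnmDE leq_addl.
  - rewrite -[X in (_ <= X)%MM](submK (lem_mlcmr mi mj)).
    by apply/mnm_lepP => x; rewrite !mnmDE leq_add2r; apply: (mnm_lepP le_t).
  - by rewrite mdegD mdeg1.
move=> j lt_j; set mj := nth _ s j.
(* The variables lying in the [j]-th colon ideal. *)
pose S := [set t : 'I_n | has (fun g => (g <= U_(t) + mj)%MM) (take j s)]%SET.
exists S; rewrite vars; apply/seteqP; split=> f.
  move=> /colon_monomial_spanP supp_f; apply/monomial_spanP => u /supp_f.
  move=> [g /(nthP 0%MM)[i]]; rewrite size_takel; last exact: ltnW.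
  move=> lt_ij; rewrite nth_take // => <- le_iu.
  have [l [z [lt_lj le_lz le_jz le_z degz]]] := lq i j lt_ij lt_j.
  have [t eqz] := lepm_mdegS le_jz degz.
  exists U_(t)%MM; first exists t => //=.
    rewrite inE; apply/hasP; exists (nth 0%MM s l).
      by rewrite -(nth_take _ lt_lj) mem_nth // size_takel // ltnW.
    by rewrite addmC -eqz.
  (* As [z = x_t m_j] divides [lcm(m_i, m_j)], hence [u m_j], cancelling [m_j] shows that [x_t]
     divides [u]. *)
  have : (z <= u + mj)%MM.
    apply: lepm_trans le_z _; rewrite lem_mlcm le_iu /=.
    by apply/mnm_lepP => x; rewrite mnmDE leq_addl.
  rewrite eqz => /mnm_lepP le; apply/mnm_lepP => x.
  by have := le x; rewrite !mnmDE addnC leq_add2r.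
move=> /monomial_spanP supp_f; apply/colon_monomial_spanP => u /supp_f.
move=> [_ [t /= + <-] le_tu]; rewrite inE => /hasP[g g_s le_g].
exists g => //; apply: lepm_trans le_g _; apply/mnm_lepP => x.
by rewrite !mnmDE leq_add2r; apply: (mnm_lepP le_tu).
Qed.

End MonomialIdealTheory.

(** * Recursive atom orderings of intervals where degrees rise by one *)

Lemma finite_enum_first (T : eqType) (A : set T) (Q : T -> Prop) :
  finite_set A -> exists t, [/\ uniq t, forall x, x \in t <-> A x
    & forall x y, x \in t -> y \in t -> Q x -> ~ Q y ->
        (index x t < index y t)%N].
Proof.
move=> /finite_seqP[s ->]; pose q x := `[< Q x >].
have mem_t x : (x \in [seq x <- undup s | q x] ++ [seq x <- undup s | ~~ q x])
    = (x \in s).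
  by rewrite mem_cat !mem_filter mem_undup -andb_orl orbN.
exists ([seq x <- undup s | q x] ++ [seq x <- undup s | ~~ q x]); split.
- rewrite cat_uniq !filter_uniq ?undup_uniq //= andbT.
  apply/hasPn => x; rewrite !mem_filter => /andP[/negPf -> _].
  by rewrite andFb.
- by move=> x; rewrite mem_t.
- move=> x y; rewrite !mem_t => x_s y_s Qx nQy.
  have qx : q x by apply/asboolP.
  have qy : ~~ q y by apply/asboolPn.
  rewrite !index_cat !mem_filter !mem_undup qx x_s (negPf qy) /=.
  by rewrite ltn_addr // index_mem mem_filter qx mem_undup.
Qed.

Lemma onth_nthE (T : Type) (x0 : T) s i :
  (i < size s)%N -> onth s i = Some (nth x0 s i).
Proof. by move=> lt_i; rewrite onthE (nth_map x0). Qed.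

Section DegreeSteps.
Local Open Scope order_scope.
Variable n : nat.
Implicit Types (a b c top x y z : mnmdvd n) (L : set (mnmdvd n)).

Lemma mdvd_lt_mdeg a b : a < b -> (mdeg a < mdeg b)%N.
Proof.
rewrite lt_neqAle => /andP[ne_ab le_ab]; rewrite ltnNge.
by apply: contra ne_ab => /(lepm_mdeg_eq le_ab) ->.
Qed.

Lemma covers_of_mdeg L a b :
  L a -> L b -> a <= b -> mdeg b = (mdeg a).+1 -> covers L a b.
Proof.
move=> La Lb le_ab deg_b; split=> //.
  by rewrite lt_neqAle le_ab andbT; apply/eqP => eq_ab; move: deg_b; rewrite eq_ab; lia.
by move=> x _ /andP[/mdvd_lt_mdeg + /mdvd_lt_mdeg]; rewrite deg_b ltnS; lia.
Qed.

Lemma minimum_uniq L a b : is_minimum L a -> is_minimum L b -> a = b.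
Proof. by move=> [La mina] [Lb minb]; apply/le_anti; rewrite mina ?minb. Qed.

Definition lcm_closed L := forall a b, L a -> L b -> L (mlcm a b).

(** For finite [L] this amounts to every cover of [a] having degree one more than [a], but it can be
    checked without knowing the covers. *)
Definition degree_step L a := forall b, L b -> a < b ->
  exists2 c, L c /\ a <= c <= b & mdeg c = (mdeg a).+1.

Lemma covers_mdeg L a b : degree_step L a -> covers L a b -> mdeg b = (mdeg a).+1.
Proof.
move=> stepL [La Lb lt_ab nbetween].
have [c [Lc /andP[le_ac le_cb]] deg_c] := stepL b Lb lt_ab.
have [<-//|ne_cb] := eqVneq c b; case: (nbetween c Lc).
rewrite [c < b]lt_neqAle ne_cb le_cb lt_neqAle le_ac !andbT; apply/eqP => eq_ac.
by move: deg_c; rewrite eq_ac; lia.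
Qed.

(* Distinct covers [b x_i] and [b x_j] of [b] are both covered by [b x_i x_j],
   so condition (ii) of a recursive atom ordering holds for every enumeration of
   the atoms; condition (i) then only asks to list the atoms in [Q] first. *)
Lemma interval_RAO L top b (Q : mnmdvd n -> Prop) :
  finite_set L -> is_maximum L top -> lcm_closed L -> L b ->
  (forall a, L a -> b <= a -> degree_step L a) ->
  exists2 t, recursive_atom_ordering (interval_in L b top) t &
    forall x y, x \in t -> y \in t -> Q x -> ~ Q y -> (index x t < index y t)%N.
Proof.
move=> finL maxL lcmL.
(* Induction on the degree gap up to [top]; [Q] varies because each atom brings its own instance of
   condition (i). *)
have [N] := ubnP (mdeg top - mdeg b); elim: N b Q => // N ih b Q lt_N Lb stepL.
have [Ltop letop] := maxL; pose P := interval_in L b top.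
have minP : is_minimum P b.
  by split; [split=> //; rewrite lexx letop | move=> x [_ /andP[]]].
have atomsP a : atoms P a <-> covers P b a.
  split=> [[bot minb]|]; last by exists b.
  by rewrite (minimum_uniq minb minP).
have finA : finite_set (atoms P).
  by apply: sub_finite_set finL => a [? _ [_ []]].
have [t [uniq_t mem_t Q_t]] := finite_enum_first Q finA; exists t => //.
have memP j a : onth t j = Some a -> [/\ L a, b < a & mdeg a = (mdeg b).+1].
  move=> t_j; have /mem_t/atomsP cov : a \in t by apply/onthP; exists j.
  have [[_ _] [La _] lt_ba _] := cov; split=> //.
  apply: covers_mdeg cov => c [Lc le_c] lt_bc.
  have [e [Le /andP[le_be le_ec]] deg_e] := stepL b Lb (lexx _) c Lc lt_bc.
  by exists e => //; split; [split=> //; rewrite le_be letop | rewrite le_be].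
apply: (@RAO_step _ _ _ _ top) => //; first exact: interval_in_top.
  move=> j aj /memP[La lt_ba deg_a].
  have -> : interval_in P aj top = interval_in L aj top.
    apply/seteqP; split=> x [] => [[Lx _] //|Lx /andP[le_ax le_x]].
    by do 2?split=> //; rewrite ?le_ax ?le_x // (le_trans (ltW lt_ba)).
  apply: ih => //; last first.
    by move=> c Lc le_c; apply: stepL => //; apply: le_trans le_c; apply: ltW.
  have := lepm_mdeg (letop _ La); move: lt_N; rewrite deg_a; lia.
(* In condition (ii) the earlier atom can be [ai] itself, with [z] the lcm of the two atoms. *)
move=> i j ai aj lt_ij t_i t_j; exists i, ai; split=> // y [Ly /andP[_ le_y]] le_iy le_jy.
have [Li lt_i deg_i] := memP _ _ t_i; have [Lj lt_j deg_j] := memP _ _ t_j.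
have Lz : L (mlcm ai aj) by apply: lcmL.
have lt_size : (j < size t)%N by rewrite -onthTE t_j.
have ne_ij : ai <> aj.
  move=> eq_ij; move: (onth_nth b _ _ _ t_i) (onth_nth b _ _ _ t_j); rewrite eq_ij => <- /eqP.
  rewrite nth_uniq // ?(ltn_trans lt_ij) //; lia.
(* At most two steps up, as [b] divides both atoms; were it only one, both atoms would equal their
   lcm. *)
have deg_z : mdeg (mlcm ai aj) = (mdeg b).+2.
  have := mdeg_mlcm_leq (ltW lt_i) (ltW lt_j); rewrite deg_i deg_j => le_z.
  apply/eqP; rewrite eqn_leq; apply/andP; split; first by lia.
  rewrite ltnNge; apply/negP => le_z'; apply: ne_ij.
  rewrite (lepm_mdeg_eq (lem_mlcml ai aj)) ?deg_i //.
  by rewrite -(lepm_mdeg_eq (lem_mlcmr ai aj)) ?deg_j.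
have inP x : L x -> b <= x -> P x by move=> Lx le_bx; split; rewrite ?le_bx ?letop.
have le_bz : b <= (mlcm ai aj : mnmdvd n) by apply: le_trans (ltW lt_i) (lem_mlcml _ _).
exists (mlcm ai aj); split.
- exact: inP.
- by apply: covers_of_mdeg; [apply/inP/ltW| apply: inP| apply: lem_mlcml| rewrite deg_z deg_i].
- by apply: covers_of_mdeg; [apply/inP/ltW| apply: inP| apply: lem_mlcmr| rewrite deg_z deg_j].
- by change (mlcm ai aj <= y)%MM; rewrite lem_mlcm; apply/andP.
Qed.

End DegreeSteps.

(** * Leaving the divisors of a monomial along the generators *)

Lemma big_mlcm_lepm n (s : seq 'X_{1..n}) w :
  (\big[@mlcm n/0%MM]_(m <- s) m <= w)%MM = all (fun m => m <= w)%MM s.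
Proof.
elim: s => [|m s ih]; last by rewrite big_cons lem_mlcm ih.
by rewrite big_nil; apply/mnm_lepP => i; rewrite mnm0E.
Qed.

(** Induction on the sum of the positions of [u] and [v]. For the later of the two, [lq_order] gives
    an earlier generator [m_l] sharing with it a multiple [z] of degree [d + 1]. Either this pair
    separates divisors of [a] from non-divisors, or [m_l] replaces the later generator. *)
Lemma lq_order_step n (s : seq 'X_{1..n}) d a u v :
  lq_order s -> (forall m, m \in s -> mdeg m = d) ->
  u \in s -> v \in s -> (u <= a)%MM -> ~~ (v <= a)%MM ->
  exists w, [/\ w \in s, (w <= mlcm u v)%MM, ~~ (w <= a)%MM
    & mdeg (mlcm a w) = (mdeg a).+1].
Proof.
move=> lq deg_s /(nthP 0%MM)[i lt_i <-] /(nthP 0%MM)[j lt_j <-].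
(* As [m_l] divides both [a] and [z], the lcm of [a] and [z] has degree at most
   [deg a + (d + 1) - d]; since [w] does not divide [a], its lcm with [a] attains this bound. *)
have exit l w z : (l < size s)%N -> w \in s -> (nth 0%MM s l <= a)%MM ->
    (nth 0%MM s l <= z)%MM -> (w <= z)%MM -> mdeg z = d.+1 ->
    ~~ (w <= a)%MM -> mdeg (mlcm a w) = (mdeg a).+1.
  move=> lt_l w_s le_la le_lz le_wz deg_z nle_wa; apply/eqP; rewrite eqn_leq.
  apply/andP; split.
    have := mdeg_mlcm_leq le_la le_lz; rewrite deg_z (deg_s (nth _ s l)) ?mem_nth //.
    suff /lepm_mdeg : (mlcm a w <= mlcm a z)%MM by lia.
    by rewrite lem_mlcm lem_mlcml; apply: lepm_trans le_wz (lem_mlcmr _ _).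
  rewrite ltnNge; apply/negP => /(lepm_mdeg_eq (lem_mlcml a w)) eq_a.
  by case/negP: nle_wa; rewrite eq_a lem_mlcmr.
have [N] := ubnP (i + j); elim: N i j lt_i lt_j => // N ih i j lt_i lt_j lt_N.
move=> le_ia nle_ja.
have [lt_ij|lt_ji|eq_ij] := ltngtP i j; last by rewrite -eq_ij le_ia in nle_ja.
- have [l [z [lt_lj le_lz le_jz le_z deg_z]]] := lq i j lt_ij lt_j.
  have lt_l := ltn_trans lt_lj lt_j.
  rewrite (deg_s (nth _ s j)) ?mem_nth // in deg_z.
  have [le_la|nle_la] := boolP (nth 0%MM s l <= a)%MM.
    exists (nth 0%MM s j); split; rewrite ?mem_nth ?lem_mlcmr //.
    by apply: (exit l _ z); rewrite ?mem_nth.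
  (* Replacing [m_j] by [m_l] keeps the path below [lcm(m_i, m_j)], since [m_l] divides [z]. *)
  have [|w [w_s le_w nle_w deg_w]] := ih i l lt_i lt_l _ le_ia nle_la.
    by lia.
  exists w; split=> //; apply: lepm_trans le_w _; rewrite lem_mlcm lem_mlcml.
  exact: lepm_trans le_lz le_z.
- have [l [z [lt_li le_lz le_iz le_z deg_z]]] := lq j i lt_ji lt_i.
  have lt_l := ltn_trans lt_li lt_i; rewrite mlcmC in le_z.
  rewrite (deg_s (nth _ s i)) ?mem_nth // in deg_z.
  (* Here the divisor [m_i] of [a] is the later one, so the crossing occurs when [m_l] does not
     divide [a]. *)
  have [le_la|nle_la] := boolP (nth 0%MM s l <= a)%MM; last first.
    exists (nth 0%MM s l); split; rewrite ?mem_nth //.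
      exact: lepm_trans le_lz le_z.
    by apply: (exit i _ z); rewrite ?mem_nth.
  have [|w [w_s le_w nle_w deg_w]] := ih l j lt_l lt_j _ le_la nle_ja.
    by lia.
  exists w; split=> //; apply: lepm_trans le_w _; rewrite lem_mlcm lem_mlcmr.
  by rewrite andbT; apply: lepm_trans le_lz le_z.
Qed.

(** * Structure of the lcm-lattice *)

Section LcmLatticeTheory.
Local Open Scope order_scope.
Variables (k : fieldType) (n d : nat) (I : set {mpoly k[n]}).
Hypothesis deg_I : generated_in_degree d I.
Implicit Types (u v w g : 'X_{1..n}) (a b c x y z : mnmdvd n).
Let L := lcm_lattice I.

(** Lists turn lcms into concatenations. Repetitions and order are harmless, as an lcm is determined
    by its multiples. *)
Lemma lcm_latticeP a : L a <-> exists2 s : seq 'X_{1..n},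
  (forall m, m \in s -> min_gens I m) & a = \big[@mlcm n/0%MM]_(m <- s) m.
Proof.
split=> [[A subA ->]|[s sub_s ->]]; first by exists (enum_fset A).
exists [fset m in s]%fset; first by move=> m /=; rewrite inE => /sub_s.
suff lub w : (\big[@mlcm n/0%MM]_(m <- s) m <= w)%MM =
    (\big[@mlcm n/0%MM]_(m <- [fset m in s]%fset) m <= w)%MM.
  apply: (@le_anti _ (mnmdvd n)); apply/andP; split.
    by have := lub (\big[@mlcm n/0%MM]_(m <- [fset m in s]%fset) m); rewrite lepm_refl.
  by have := lub (\big[@mlcm n/0%MM]_(m <- s) m); rewrite lepm_refl => /esym.
by rewrite !big_mlcm_lepm; apply: eq_all_r => m; rewrite inE.
Qed.

Lemma lcm_lattice0 : L 0%MM.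
Proof. by apply/lcm_latticeP; exists [::]; rewrite ?big_nil. Qed.

Lemma lcm_lattice_gen g : min_gens I g -> L g.
Proof.
move=> Ig; apply/lcm_latticeP; exists [:: g] => [m|].
  by rewrite inE => /eqP ->.
by rewrite big_cons big_nil mlcm0.
Qed.

Lemma lcm_lattice_lcm : lcm_closed L.
Proof.
move=> _ _ /lcm_latticeP[s sub_s ->] /lcm_latticeP[t sub_t ->].
apply/lcm_latticeP; exists (s ++ t).
  by move=> m; rewrite mem_cat => /orP[/sub_s|/sub_t].
elim: s {sub_s} => [|m s ih]; first by rewrite big_nil mlc0m.
rewrite cat_cons !big_cons -ih; apply/mnmP => i; rewrite !mnmE; exact/esym/maxnA.
Qed.

(** If all generators with lcm [a] divided [w], so would [a]. *)
Lemma lcm_lattice_nle a w : L a -> ~~ (a <= w)%MM ->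
  exists g, [/\ min_gens I g, (g <= a)%MM & ~~ (g <= w)%MM].
Proof.
move=> /lcm_latticeP[s sub_s eq_a]; have := lepm_refl a.
rewrite {1 3}eq_a !big_mlcm_lepm => /allP leA /allPn[g g_s nle_gw].
by exists g; split=> //; [apply: sub_s | apply: leA].
Qed.

Lemma mnmdvd_le0 a : (0%MM : mnmdvd n) <= a.
Proof. by apply/mnm_lepP => i; rewrite mnm0E. Qed.

Lemma mnmdvd_lt0 a : ((0%MM : mnmdvd n) < a) = (a != 0%MM).
Proof. by rewrite lt_neqAle eq_sym mnmdvd_le0 andbT. Qed.

Lemma lcm_lattice_minimum : is_minimum L 0%MM.
Proof. by split=> [|x _]; [exact: lcm_lattice0 | exact: mnmdvd_le0]. Qed.

Lemma lcm_lattice_gen_below a : L a -> a != 0%MM ->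
  exists g, [/\ min_gens I g, (g <= a)%MM & g != 0%MM].
Proof.
move=> La nz_a; have [|g [Ig le_ga nle_g0]] := @lcm_lattice_nle a 0%MM La.
  by apply: contra nz_a => le_a0; apply/eqP/lepm_mdeg_eq; rewrite ?mdeg0.
by exists g; split=> //; apply: contra nle_g0 => /eqP ->; exact: lepm_refl.
Qed.

Lemma lcm_lattice_mdeg a : L a -> a != 0%MM -> (0 < d <= mdeg a)%N.
Proof.
move=> La /(lcm_lattice_gen_below La)[g [/deg_I <- /lepm_mdeg -> nz_g]].
by rewrite andbT lt0n mdeg_eq0.
Qed.

Lemma lcm_lattice_atoms_cover a : atoms L a <-> covers L 0%MM a.
Proof.
split=> [[bot minb]|]; last by exists 0%MM => //; exact: lcm_lattice_minimum.
by rewrite (minimum_uniq minb lcm_lattice_minimum).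
Qed.

(** Every element other than 1 is a multiple of a generator, and no such element has degree below
    [d]. Positivity of [d] keeps 1 from being a generator. *)
Lemma lcm_lattice_atomsP : (0 < d)%N -> forall a, atoms L a <-> min_gens I a.
Proof.
move=> d_gt0 a; rewrite lcm_lattice_atoms_cover; split=> [|Ia].
  move=> [_ La]; rewrite mnmdvd_lt0 => nz_a nbetween.
  have [g [Ig le_ga nz_g]] := lcm_lattice_gen_below La nz_a.
  have [<-//|ne_ga] := eqVneq g a.
  case: (nbetween g (lcm_lattice_gen Ig)).
  by rewrite mnmdvd_lt0 nz_g lt_neqAle ne_ga.
split; [exact: lcm_lattice0 | exact: lcm_lattice_gen | |].
  by rewrite mnmdvd_lt0 -mdeg_eq0 (deg_I Ia) -lt0n.
move=> x Lx /andP[]; rewrite mnmdvd_lt0 => /(lcm_lattice_mdeg Lx)/andP[_ le_d].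
by move=> /mdvd_lt_mdeg; rewrite (deg_I Ia) ltnNge le_d.
Qed.

Lemma lcm_lattice_eq0 : d = 0%N -> L = [set 0%MM].
Proof.
move=> d0; apply/seteqP; split=> [a La /=|_ ->]; last exact: lcm_lattice0.
by apply/eqP; apply: contraT => /(lcm_lattice_mdeg La); rewrite d0.
Qed.

(** * From linear quotients to gradedness and shellability *)

Section LinearQuotientOrder.
Variable s : seq 'X_{1..n}.
Hypotheses (uniq_s : uniq s) (mem_s : forall m, m \in s <-> min_gens I m).
Hypothesis lq_s : lq_order s.

Lemma lcm_lattice_degree_step a : L a -> a != 0%MM -> degree_step L a.
Proof.
move=> La nz_a b Lb lt_ab.
have le_ab : (a <= b)%MM := ltW lt_ab.
(* Moving from a generator [u] of [a] to a generator [v] of [b] outside [a] yields [w] dividing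
   [lcm(u, v)], hence [b], with [lcm(a, w)] one degree above [a]. *)
have [u [Iu le_ua _]] := lcm_lattice_gen_below La nz_a.
have [|v [Iv le_vb nle_va]] := @lcm_lattice_nle b a Lb.
  by apply/negP => le_ba; have := lt_le_trans lt_ab le_ba; rewrite ltxx.
have deg_s m : m \in s -> mdeg m = d by move/mem_s; exact: deg_I.
have [w [w_s le_w nle_wa deg_w]] := lq_order_step lq_s deg_s
  (proj2 (mem_s u) Iu) (proj2 (mem_s v) Iv) le_ua nle_va.
exists (mlcm a w) => //; split.
  by apply: lcm_lattice_lcm => //; apply/lcm_lattice_gen/mem_s.
apply/andP; split; first exact: lem_mlcml.
change (mlcm a w <= b)%MM; rewrite lem_mlcm le_ab /=.
apply: lepm_trans le_w _; rewrite lem_mlcm le_vb andbT.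
exact: lepm_trans le_ua le_ab.
Qed.

Lemma lcm_lattice_maximum : is_maximum L (\big[@mlcm n/0%MM]_(m <- s) m).
Proof.
split=> [|a La]; first by apply/lcm_latticeP; exists s => // m /mem_s.
apply: contraT => /(lcm_lattice_nle La)[g [/mem_s g_s _]].
have := lepm_refl (\big[@mlcm n/0%MM]_(m <- s) m); rewrite {1}big_mlcm_lepm.
by move=> /allP/(_ g g_s) ->.
Qed.

Lemma lcm_lattice_finite : finite_set L.
Proof.
have [_ le_top] := lcm_lattice_maximum.
apply: sub_finite_set (finite_mdeg_lt n (mdeg (\big[@mlcm n/0%MM]_(m <- s) m)).+1).
by move=> a La /=; rewrite ltnS; apply/lepm_mdeg/le_top.
Qed.

Lemma lcm_lattice_d_degree_graded : d_degree_graded d L.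
Proof.
split=> [a b /eqP nz_a _ cov|a at_a].
  have [La _ _ _] := cov; apply: covers_mdeg cov.
  exact: lcm_lattice_degree_step.
have [_ La] := proj1 (lcm_lattice_atoms_cover a) at_a.
rewrite mnmdvd_lt0 => /(lcm_lattice_mdeg La)/andP[d_gt0 _] _.
by apply/deg_I/(lcm_lattice_atomsP d_gt0).
Qed.

Lemma lcm_lattice_CL_shellable : CL_shellable L.
Proof.
have [deg_cov deg_atom] := lcm_lattice_d_degree_graded.
have maxL := lcm_lattice_maximum; have finL := lcm_lattice_finite.
split.
  (* The rank must count the jump from 1 to the atoms, of degree [d], as a single step. *)
  apply: (@graded_of_rank _ _ L (fun a => if a == 0%MM then 0%N else (mdeg a - d).+1)
    _ _ finL lcm_lattice_minimum maxL) => a b cov.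
  have [La Lb lt_ab _] := cov.
  have nz_b : b != 0%MM by rewrite -mnmdvd_lt0; apply: le_lt_trans (mnmdvd_le0 a) lt_ab.
  rewrite (negPf nz_b); case: eqP => [eq_a|/eqP nz_a].
    by rewrite deg_atom ?subnn //; apply/lcm_lattice_atoms_cover; rewrite -eq_a.
  rewrite (deg_cov a b (elimN eqP nz_a) (elimN eqP nz_b) cov).
  by rewrite subSn //; case/andP: (lcm_lattice_mdeg La nz_a).
have [d0|d_gt0] := posnP d.
  (* Here the lattice is the single point 1, without atoms. *)
  have L0 := lcm_lattice_eq0 d0.
  exists [::]; apply: (@RAO_trivial _ (mnmdvd n) L _ 0%MM 0%MM).
  - exact: lcm_lattice_minimum.
  - by rewrite L0; split=> // x ->.
  - by rewrite L0 setUid; exact: setDv.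
  - split=> // a; split=> // /lcm_lattice_atoms_cover[_]; rewrite L0 => ->.
    by rewrite ltxx.
have atomsP := lcm_lattice_atomsP d_gt0.
exists s; apply: (@RAO_step _ (mnmdvd n) L _ (\big[@mlcm n/0%MM]_(m <- s) m)) => //.
- by split=> // a; rewrite atomsP.
- move=> j aj s_j; have /mem_s Ij : aj \in s by apply/onthP; exists j.
  apply: interval_RAO => //; [exact: lcm_lattice_lcm | exact: lcm_lattice_gen |].
  move=> a La le_a; apply: lcm_lattice_degree_step => //.
  rewrite -mdeg_eq0 -lt0n; apply: leq_trans d_gt0 _.
  by rewrite -(deg_I Ij); exact: lepm_mdeg.
move=> i j ai aj lt_ij s_i s_j.
have lt_j : (j < size s)%N by rewrite -onthTE s_j.
have [l [z [lt_lj le_lz le_jz le_z deg_z]]] := lq_s lt_ij lt_j.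
have lt_l := ltn_trans lt_lj lt_j.
rewrite (onth_nth 0%MM _ _ _ s_i) (onth_nth 0%MM _ _ _ s_j) in le_z le_jz deg_z.
exists l, (nth 0%MM s l); split; rewrite ?(onth_nthE 0%MM) //.
have /mem_s Il := mem_nth 0%MM lt_l.
have /mem_s Ij : aj \in s by apply/onthP; exists j.
have ne_lj : nth 0%MM s l <> aj.
  rewrite -(onth_nth 0%MM _ _ _ s_j) => /eqP; rewrite nth_uniq //.
  by rewrite (ltn_eqF lt_lj).
(* The lcm divides [z], of degree [d + 1], and has degree above [d] because [m_l] and [m_j] are
   distinct of degree [d]. This puts [z] in [L]. *)
have eq_z : z = mlcm (nth 0%MM s l) aj.
  apply/esym/lepm_mdeg_eq; first by rewrite lem_mlcm le_lz.
  rewrite deg_z ltnNge; apply/negP => le_deg; apply: ne_lj.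
  have eq_j := lepm_mdeg_eq (lem_mlcmr _ _) le_deg.
  by apply: lepm_mdeg_eq; [rewrite eq_j lem_mlcml | rewrite !deg_I].
have Lz : L z by rewrite eq_z; apply: lcm_lattice_lcm; apply: lcm_lattice_gen.
move=> y Ly le_iy le_jy; exists z; split=> //.
- by apply: covers_of_mdeg => //; [exact: lcm_lattice_gen | rewrite deg_z !deg_I].
- by apply: covers_of_mdeg => //; exact: lcm_lattice_gen.
- by apply: lepm_trans le_z _; rewrite lem_mlcm; apply/andP.
Qed.

End LinearQuotientOrder.

(** * From a recursive atom ordering to linear quotients *)

Lemma CL_shellable_lq_order : d_degree_graded d L -> CL_shellable L ->
  exists s, [/\ uniq s, forall m, m \in s <-> min_gens I m & lq_order s].
Proof.
move=> [deg_cov _] [_ [s rao]].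
have [d0|d_gt0] := posnP d.
  (* With 1 as the only possible generator, the order has at most one entry and no pair to test. *)
  have I0 g : min_gens I g -> g = 0%MM.
    by move=> /deg_I/eqP; rewrite d0 mdeg_eq0 => /eqP.
  case: (pselect (min_gens I 0%MM)) => gen0.
    exists [:: 0%MM]; split=> // [m|i j lt_ij]; last by rewrite ltnS; case: j lt_ij.
    by rewrite inE; split=> [/eqP ->|/I0 ->].
  by exists [::]; split=> // m; split=> // Im; case: gen0; rewrite -(I0 m Im).
have atomsP := lcm_lattice_atomsP d_gt0.
have [uniq_s mem_at] : atom_ordering L s by case: rao.
have mem_s m : m \in s <-> min_gens I m by rewrite mem_at atomsP.
have inL i : (i < size s)%N -> min_gens I (nth 0%MM s i) by move/(mem_nth 0%MM)/mem_s.
have nz g : min_gens I g -> g <> 0%MM.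
  by move=> Ig; apply/eqP; rewrite -mdeg_eq0 (deg_I Ig) -lt0n.
exists s; split=> // i j lt_ij lt_j; have lt_i := ltn_trans lt_ij lt_j.
have [Ii Ij] := (inL i lt_i, inL j lt_j).
(* In the trivial case all generators equal [top], against [i < j] and uniqueness. *)
case: rao => [bot top minL _ L2 _|top _ _ _ cond].
  have bot0 := minimum_uniq minL lcm_lattice_minimum.
  have eq_top g : min_gens I g -> g = top.
    move=> Ig; apply: contrapT => ne_top.
    suff : (L `\` [set bot; top]) g by rewrite L2.
    split; first exact: lcm_lattice_gen.
    by case=> //; rewrite bot0; exact: nz.
  have /eqP := eq_top _ Ii; rewrite -(eq_top _ Ij) nth_uniq //.
  by rewrite (ltn_eqF lt_ij).
have [l [al [lt_lj s_l]]] := cond i j _ _ lt_ij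
  (onth_nthE 0%MM lt_i) (onth_nthE 0%MM lt_j).
(* Condition (ii) at this [y] makes [z] divide the lcm; as [z] covers [m_j], gradedness gives its
   degree. *)
move=> /(_ (mlcm (nth 0%MM s i) (nth 0%MM s j))).
case; [by apply: lcm_lattice_lcm; exact: lcm_lattice_gen | exact: lem_mlcml
  | exact: lem_mlcmr |].
move=> z [Lz [_ _ /ltW le_lz _] cov le_z]; have [_ _ lt_jz _] := cov.
exists l, z; split=> //; first by rewrite (onth_nth 0%MM _ _ _ s_l).
  exact: ltW lt_jz.
apply: deg_cov => //; first exact: nz.
by apply/eqP; rewrite -mnmdvd_lt0; apply: le_lt_trans (mnmdvd_le0 _) lt_jz.
Qed.

End LcmLatticeTheory.

Theorem theorem1p1 (k : fieldType) (n d : nat) (I : set {mpoly k[n]}) :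
  monomial_ideal I -> generated_in_degree d I ->
  (linear_quotients I <->
   d_degree_graded d (lcm_lattice I) /\ CL_shellable (lcm_lattice I)).
Proof.
move=> monI deg_I; rewrite linear_quotientsE //; split.
  move=> [s [uniq_s mem_s lq_s]]; split.
    exact: (lcm_lattice_d_degree_graded deg_I mem_s lq_s).
  exact: (lcm_lattice_CL_shellable deg_I uniq_s mem_s lq_s).
by move=> [deg_L cl_L]; exact: (CL_shellable_lq_order deg_I deg_L cl_L).
Qed.
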